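(* Let $G$ be a discrete group acting on a directed graph $E=(E^0,E^1,r,s)$, and let $\varphi\colon G\times E^1\to G$ be a cocycle for this action. Let $B=C_0(E^0)\rtimes_\alpha G$, where $\alpha_g(a)(v)=a(g^{-1}v)$, and let $M$ be the Exel-Pardo $B$-correspondence described in the context. Then $Y^\varphi\simeq M$ as $B$-correspondences.
   Context: An action of $G$ on the directed graph $E$ is an action on the sets $E^0$ and $E^1$ with $r(ge)=g\,r(e)$, $s(ge)=g\,s(e)$. A cocycle for the action is a map $\varphi\colon G\times E^1\to G$ with $\varphi(gh,e)=\varphi(g,he)\varphi(h,e)$ and $\varphi(g,e)s(e)=g\,s(e)$ for all $g,h\in G$, $e\in E^1$. Let $A=C_0(E^0)=c_0(E^0)$ and let $(i_A,i_G)$ be the universal covariant homomorphism of $(A,G)$ in the multiplier algebra $M(B)$ of the full crossed product $B=A\rtimes_\alpha G$. Let $\delta_v\in A$ be the characteristic function of $\{v\}$ and $\delta_{v,g}=i_A(\delta_v)i_G(g)\in B$. The $B$-correspondence $Y^\varphi$ is the completion of $C_c(E^1\times G)=\mathrm{span}\{\chi_{e,g}\}$, where $\chi_{e,g}$ is the characteristic function of $\{(e,g)\}$, with operations determined by: $\langle\chi_{e,g},\chi_{e',h}\rangle=0$ if $e\ne e'$ and $\langle\chi_{e,g},\chi_{e,h}\rangle=\delta_{g^{-1}s(e),\,g^{-1}h}$; $\chi_{e,h}\cdot\delta_{v,g}=\chi_{e,hg}$ if $s(e)=hv$ and $0$ otherwise; $\delta_{v,g}\cdot\chi_{e,h}=\chi_{ge,\varphi(g,e)h}$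 if $v=r(ge)$ and $0$ otherwise. The Exel-Pardo correspondence $M$: for each $e\in E^1$ let $B^e=i_A(\delta_{s(e)})B$, a closed right ideal of $B$, regarded as a Hilbert $B$-module with $\langle b,c\rangle=b^*c$. Let $M=\bigoplus_{e\in E^1}B^e$ be the Hilbert $B$-module direct sum, with elements $m=(m_e)_{e\in E^1}$, $m_e\in B^e$. The left $B$-module structure is the integrated form of the covariant pair of left actions of $A$ and $G$ determined by $(\delta_v\cdot m)_e=m_e$ if $v=r(e)$ and $0$ otherwise, and $(g\cdot m)_e=i_A(\delta_{s(e)})\,i_G(\varphi(g,g^{-1}e))\,m_{g^{-1}e}$, for $v\in E^0$, $g\in G$, $e\in E^1$. An isomorphism of $B$-correspondences is a surjective linear map preserving the $B$-valued inner products and commuting with the left and right $B$-actions. *)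

(* Defs.v *)
From HB Require Import structures.
From mathcomp Require Import all_boot all_order all_algebra finmap.
From mathcomp Require Import complex.
From mathcomp Require Import all_classical all_reals all_analysis.
From mathcomp Require Import showcase.summability.

Set Implicit Arguments.
Unset Strict Implicit.
Unset Printing Implicit Defensive.

Import Order.TTheory GRing.Theory Num.Theory.
Import numFieldNormedType.Exports.

Local Open Scope classical_set_scope.
Local Open Scope ring_scope.

(* Algebras need not be unital, so the multiplication is not the one of the
   ring hierarchy of MathComp. *)
HB.mixin Record isStarAlgebra (R : realType) A & GRing.Lmodule R[i] A := {
  smul : A -> A -> A;
  star : A -> A;
  smulA : associative smul;
  smul_linearl : forall b, linear (smul^~ b);
  smul_linearr : forall a, linear (smul a);
  starD : {morph star : a b / a + b};
  starZ : forall (k : R[i]) a, star (k *: a) = k^* *: star a;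
  starM : forall a b, star (smul a b) = smul (star b) (star a);
  starK : involutive star }.

#[short(type="starAlgType")]
HB.structure Definition StarAlgebra (R : realType) :=
  { A of isStarAlgebra R A & GRing.Lmodule R[i] A }.

Notation "a ** b" := (smul a b) (at level 40, left associativity) : ring_scope.

HB.mixin Record isCStarAlgebra (R : realType) B
    & StarAlgebra R B & CompleteNormedModule R[i] B := {
  normr_smul : forall a b : B, `|a ** b| <= `|a| * `|b|;
  normr_cstar : forall a : B, `|star a ** a| = `|a| ^+ 2 }.

#[short(type="cstarType")]
HB.structure Definition CStarAlgebra (R : realType) :=
  { B of isCStarAlgebra R B & StarAlgebra R B & CompleteNormedModule R[i] B }.

Definition cstar_ge0 (R : realType) (B : cstarType R) (b : B) :=
  exists c : B, b = star c ** c.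

(* Inner products are linear in the second variable. *)
HB.mixin Record isHilbertModule (R : realType) (B : cstarType R) X
    & CompleteNormedModule R[i] X := {
  ract : X -> B -> X;
  inner : X -> X -> B;
  ract_linearl : forall b, linear (ract^~ b);
  ract_linearr : forall x, linear (ract x);
  ractA : forall x b c, ract (ract x b) c = ract x (b ** c);
  inner_linear : forall x, linear (inner x);
  inner_ract : forall x y b, inner x (ract y b) = inner x y ** b;
  inner_star : forall x y, star (inner x y) = inner y x;
  inner_ge0 : forall x, cstar_ge0 (inner x x);
  inner_eq0 : forall x, inner x x = 0 -> x = 0;
  normr_inner : forall x, `|x| ^+ 2 = `|inner x x| }.

#[short(type="hilbertModType")]
HB.structure Definition HilbertModule (R : realType) (B : cstarType R) :=
  { X of isHilbertModule R B X & CompleteNormedModule R[i] X }.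

(* A homomorphism of A into the adjointable operators on X, uncurried; the
   last clause says that pi a is adjointable with adjoint pi (star a). *)
Definition star_rep (R : realType) (A : starAlgType R) (B : cstarType R)
    (X : hilbertModType B) (pi : A -> X -> X) : Prop :=
  [/\ forall x, linear (pi^~ x),
      forall a b x, pi (a ** b) x = pi a (pi b x) &
      forall a x y, inner (pi a x) y = inner x (pi (star a) y) :> B].

Definition unitary_rep (R : realType) (G : groupType) (B : cstarType R)
    (X : hilbertModType B) (U : G -> X -> X) : Prop :=
  [/\ forall x, U 1%g x = x,
      forall g h x, U (g * h)%g x = U g (U h x) &
      forall g x y, inner (U g x) y = inner x (U g^-1%g y) :> B].

HB.mixin Record isCorrespondence (R : realType) (B : cstarType R) X
    & HilbertModule R B X := {
  lact : B -> X -> X;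
  lact_star_rep : star_rep lact }.

#[short(type="corrType")]
HB.structure Definition Correspondence (R : realType) (B : cstarType R) :=
  { X of isCorrespondence R B X & HilbertModule R B X }.

Definition corr_iso (R : realType) (B : cstarType R) (X Y : corrType B)
    (Psi : X -> Y) : Prop :=
  [/\ linear Psi,
      set_surj setT setT Psi,
      forall x y, inner (Psi x) (Psi y) = inner x y :> B,
      forall b x, Psi (lact b x) = lact b (Psi x) &
      forall b x, Psi (ract x b) = ract (Psi x) b].

Definition lspan (R : realType) (X : lmodType R[i]) (T : Type) (f : T -> X) :
    set X :=
  [set x | exists s : seq (R[i] * T), x = \sum_(p <- s) p.1 *: f p.2].

Definition nondegenerate (R : realType) (A : starAlgType R) (B : cstarType R)
    (X : hilbertModType B) (pi : A -> X -> X) : Prop :=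
  dense (lspan (fun p : A * X => pi p.1 p.2)).

(* B as a Hilbert module over itself. The multiplier algebra M(B) is realised
   as the algebra of adjointable operators on selfmod B, with b : B embedded as
   the operator c |-> b ** c. *)
Definition selfmod (R : realType) (B : cstarType R) : Type := B.

Section SelfMod.
Variables (R : realType) (B : cstarType R).

HB.instance Definition _ := CompleteNormedModule.on (selfmod B).

Definition self_inner (b c : selfmod B) : B := star (b : B) ** (c : B).

Fact self_ract_linearl (b : B) : linear ((fun x : selfmod B => (x : B) ** b)).
Proof. exact: smul_linearl. Qed.

Fact self_ract_linearr (x : selfmod B) : linear (fun b : B => (x : B) ** b).
Proof. exact: smul_linearr. Qed.

Fact self_ractA (x : selfmod B) (b c : B) :
  ((x : B) ** b) ** c = (x : B) ** (b ** c).
Proof. by rewrite smulA. Qed.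

Fact self_inner_linear (x : selfmod B) : linear (self_inner x).
Proof. exact: smul_linearr. Qed.

Fact self_inner_ract (x y : selfmod B) (b : B) :
  self_inner x ((y : B) ** b) = self_inner x y ** b.
Proof. by rewrite /self_inner smulA. Qed.

Fact self_inner_star (x y : selfmod B) :
  star (self_inner x y) = self_inner y x.
Proof. by rewrite /self_inner starM starK. Qed.

Fact self_inner_ge0 (x : selfmod B) : cstar_ge0 (self_inner x x).
Proof. by exists x. Qed.

Fact self_normr_inner (x : selfmod B) : `|x| ^+ 2 = `|self_inner x x|.
Proof. by rewrite /self_inner normr_cstar. Qed.

Fact self_inner_eq0 (x : selfmod B) : self_inner x x = 0 -> x = 0.
Proof.
move=> x0; apply/eqP; rewrite -normr_eq0 -sqrf_eq0.
by rewrite self_normr_inner x0 normr0.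
Qed.

HB.instance Definition _ := isHilbertModule.Build R B (selfmod B)
  self_ract_linearl self_ract_linearr self_ractA self_inner_linear
  self_inner_ract self_inner_star self_inner_ge0 self_inner_eq0
  self_normr_inner.

End SelfMod.

Definition vanish_at_infinity (R : realType) (V : choiceType) (f : V -> R[i]) :=
  forall eps : R[i], 0 < eps -> finite_set [set v | eps <= `|f v|].

Record c0 (R : realType) (V : choiceType) := C0 {
  c0_fun :> V -> R[i];
  c0_vanish : vanish_at_infinity c0_fun }.

Section C0.
Variables (R : realType) (V : choiceType).
Local Notation A := (c0 R V).

HB.instance Definition _ := gen_eqMixin A.
HB.instance Definition _ := gen_choiceMixin A.

Lemma c0P (f g : A) : f =1 g -> f = g.
Proof.
case: f g => [f hf] [g hg] /= /funext fg; case: _ / fg hg => hg.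
by congr C0; exact: Prop_irrelevance.
Qed.

Lemma vanish0 : vanish_at_infinity (fun _ : V => 0 : R[i]).
Proof.
move=> e e0; rewrite [X in finite_set X](_ : _ = set0); first exact: finite_set0.
by apply/seteqP; split => // v /=; rewrite normr0 (lt_geF e0).
Qed.

Lemma vanish_le (k : R[i]) (f g : V -> R[i]) : 0 <= k ->
  (forall v, `|g v| <= k * `|f v|) ->
  vanish_at_infinity f -> vanish_at_infinity g.
Proof.
move=> k0 gf hf e e0; have k1 : 0 < k + 1 by apply: ltr_wpDl.
apply: sub_finite_set (hf (e / (k + 1)) (divr_gt0 e0 k1)) => v /= ev.
rewrite ler_pdivrMr //; apply: (le_trans ev); apply: (le_trans (gf v)).
by rewrite mulrDr mulr1 mulrC lerDl.
Qed.

Lemma vanishD (f g : V -> R[i]) : vanish_at_infinity f ->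
  vanish_at_infinity g -> vanish_at_infinity (fun v => f v + g v).
Proof.
move=> hf hg e e0; have e2 : 0 < e / 2%:R by apply: divr_gt0.
have := hf _ e2; have := hg _ e2 => gfin ffin.
have fin : finite_set ([set v | e / 2%:R <= `|f v|] `|`
                       [set v | e / 2%:R <= `|g v|]) by rewrite finite_setU.
apply: sub_finite_set fin => v /= efg.
have [le_f|lt_f] := real_leP (gtr0_real e2) (normr_real (f v)); first by left.
right; have [//|lt_g] := real_leP (gtr0_real e2) (normr_real (g v)).
have := le_lt_trans (ler_normD (f v) (g v)) (ltrD lt_f lt_g).
by rewrite -splitr => /(le_lt_trans efg); rewrite ltxx.
Qed.

Lemma vanishN (f : V -> R[i]) :
  vanish_at_infinity f -> vanish_at_infinity (fun v => - f v).
Proof. by apply: (@vanish_le 1) => // v; rewrite normrN mul1r. Qed.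

Lemma vanishZ (k : R[i]) (f : V -> R[i]) :
  vanish_at_infinity f -> vanish_at_infinity (fun v => k * f v).
Proof. by apply: (@vanish_le `|k|) => // v; rewrite normrM. Qed.

Lemma vanish_conj (f : V -> R[i]) :
  vanish_at_infinity f -> vanish_at_infinity (fun v => (f v)^*).
Proof. by apply: (@vanish_le 1) => // v; rewrite norm_conjC mul1r. Qed.

Lemma c0_bounded (f : A) : exists2 k : R[i], 0 <= k & forall v, `|f v| <= k.
Proof.
have /finite_fsetP[F FE] := c0_vanish f (ltr01 : 0 < 1 :> R[i]).
exists (1 + \sum_(w <- F) `|f w|).
  by rewrite addr_ge0 // sumr_ge0.
move=> v; have [le1|/ltW lt1] := real_leP (real1 _) (normr_real (f v)); last first.
  by rewrite (le_trans lt1) // lerDl sumr_ge0.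
have vF : v \in F.
  by have : [set` F] v by rewrite -FE.
rewrite (big_fsetD1 v vF) /= addrCA lerDl addr_ge0 // sumr_ge0 //.
Qed.

Lemma vanishM (f g : A) : vanish_at_infinity (fun v => f v * g v).
Proof.
have [k k0 fk] := c0_bounded f.
apply: (vanish_le k0 _ (c0_vanish g)) => v.
by rewrite normrM ler_wpM2r.
Qed.

Lemma vanish_delta (v : V) : vanish_at_infinity (fun w => (w == v)%:R : R[i]).
Proof.
move=> e e0; apply: sub_finite_set (finite_set1 v) => w /=.
by case: eqP => // _; rewrite normr0 (lt_geF e0).
Qed.

Definition c0_zero : A := C0 vanish0.
Definition c0_add (f g : A) : A := C0 (vanishD (c0_vanish f) (c0_vanish g)).
Definition c0_opp (f : A) : A := C0 (vanishN (c0_vanish f)).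
Definition c0_scale (k : R[i]) (f : A) : A := C0 (vanishZ k (c0_vanish f)).
Definition c0_mul (f g : A) : A := C0 (vanishM f g).
Definition c0_conj (f : A) : A := C0 (vanish_conj (c0_vanish f)).
Definition c0_delta (v : V) : A := C0 (vanish_delta v).

Fact c0_addA : associative c0_add.
Proof. by move=> f g h; apply/c0P => v /=; rewrite addrA. Qed.
Fact c0_addC : commutative c0_add.
Proof. by move=> f g; apply/c0P => v /=; rewrite addrC. Qed.
Fact c0_add0 : left_id c0_zero c0_add.
Proof. by move=> f; apply/c0P => v /=; rewrite add0r. Qed.
Fact c0_addN : left_inverse c0_zero c0_opp c0_add.
Proof. by move=> f; apply/c0P => v /=; rewrite addNr. Qed.

HB.instance Definition _ := GRing.isZmodule.Build A
  c0_addA c0_addC c0_add0 c0_addN.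

Fact c0_scaleA k l (f : A) : c0_scale k (c0_scale l f) = c0_scale (k * l) f.
Proof. by apply/c0P => v /=; rewrite mulrA. Qed.
Fact c0_scale1 : left_id 1 c0_scale.
Proof. by move=> f; apply/c0P => v /=; rewrite mul1r. Qed.
Fact c0_scaleDr : right_distributive c0_scale +%R.
Proof. by move=> k f g; apply/c0P => v /=; rewrite mulrDr. Qed.
Fact c0_scaleDl (f : A) : {morph c0_scale^~ f : k l / k + l}.
Proof. by move=> k l; apply/c0P => v /=; rewrite mulrDl. Qed.

HB.instance Definition _ := GRing.Zmodule_isLmodule.Build R[i] A
  c0_scaleA c0_scale1 c0_scaleDr c0_scaleDl.

Fact c0_mulA : associative c0_mul.
Proof. by move=> f g h; apply/c0P => v /=; rewrite mulrA. Qed.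
Fact c0_mul_linearl (g : A) : linear (c0_mul^~ g).
Proof. by move=> k f h; apply/c0P => v /=; rewrite mulrDl mulrA. Qed.
Fact c0_mul_linearr (f : A) : linear (c0_mul f).
Proof. by move=> k g h; apply/c0P => v /=; rewrite mulrDr mulrCA. Qed.
Fact c0_conjD : {morph c0_conj : f g / f + g}.
Proof. by move=> f g; apply/c0P => v /=; rewrite rmorphD. Qed.
Fact c0_conjZ k (f : A) : c0_conj (k *: f) = k^* *: c0_conj f.
Proof. by apply/c0P => v /=; rewrite rmorphM. Qed.
Fact c0_conjM (f g : A) : c0_conj (c0_mul f g) = c0_mul (c0_conj g) (c0_conj f).
Proof. by apply/c0P => v /=; rewrite rmorphM mulrC. Qed.
Fact c0_conjK : involutive c0_conj.
Proof. by move=> f; apply/c0P => v /=; rewrite conjCK. Qed.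

HB.instance Definition _ := isStarAlgebra.Build R A
  c0_mulA c0_mul_linearl c0_mul_linearr c0_conjD c0_conjZ c0_conjM c0_conjK.

End C0.

Record digraph := Digraph {
  vertex : choiceType;
  edge : choiceType;
  rng : edge -> vertex;
  src : edge -> vertex }.

Record graph_action (G : groupType) (E : digraph) := GraphAction {
  vact : G -> vertex E -> vertex E;
  eact : G -> edge E -> edge E;
  vact1 : forall v, vact 1%g v = v;
  vactM : forall g h v, vact (g * h)%g v = vact g (vact h v);
  eact1 : forall e, eact 1%g e = e;
  eactM : forall g h e, eact (g * h)%g e = eact g (eact h e);
  rng_act : forall g e, rng (eact g e) = vact g (rng e);
  src_act : forall g e, src (eact g e) = vact g (src e) }.

Definition is_cocycle (G : groupType) (E : digraph) (act : graph_action G E)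
    (phi : G -> edge E -> G) : Prop :=
  (forall g h e, phi (g * h)%g e = (phi g (eact act h e) * phi h e)%g) /\
  (forall g e, vact act (phi g e) (src e) = vact act g (src e)).

Section CrossedProduct.
Variables (R : realType) (G : groupType) (E : digraph).
Variable act : graph_action G E.
Local Notation A := (c0 R (vertex E)).

Fact alpha_vanish (g : G) (a : A) :
  vanish_at_infinity (fun v => a (vact act g^-1%g v)).
Proof.
move=> e /(c0_vanish a) /(finite_image (vact act g)).
apply: sub_finite_set => v /= ev; exists (vact act g^-1%g v) => //.
by rewrite -vactM mulgV vact1.
Qed.

Definition alpha (g : G) (a : A) : A := C0 (alpha_vanish g a).

Definition covariant (B : cstarType R) (X : hilbertModType B)
    (pi : A -> X -> X) (U : G -> X -> X) : Prop :=
  [/\ star_rep pi, unitary_rep U &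
      forall g a x, pi (alpha g a) x = U g (pi a (U g^-1%g x))].

(* The full crossed product of A by G: a C*-algebra B with a universal
   covariant homomorphism (iA, iG) into M(B). As G is discrete, the
   multipliers iA(a) iG(g) lie in B; iAG a g is this element of B. *)
Record crossed_product (B : cstarType R) := CrossedProduct {
  iA : A -> selfmod B -> selfmod B;
  iG : G -> selfmod B -> selfmod B;
  iAG : A -> G -> B;
  cp_covariant : covariant iA iG;
  cp_nondegenerate : nondegenerate iA;
  iAGE : forall a g (b : B), iAG a g ** b = iA a (iG g b) :> B;
  cp_dense : dense (lspan (fun p : A * G => iAG p.1 p.2));
  (* The last two clauses say that the canonical extension of L to M(B) maps
     iA a to pi a and iG g to U g. *)
  cp_universal : forall (D : cstarType R) (pi : A -> selfmod D -> selfmod D)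
      (U : G -> selfmod D -> selfmod D),
    covariant pi U -> nondegenerate pi ->
    exists L : B -> selfmod D -> selfmod D,
      [/\ star_rep L, nondegenerate L,
          forall a (b : B) d, L (iA a b) d = pi a (L b d) &
          forall g (b : B) d, L (iG g b) d = U g (L b d)] }.

Variables (B : cstarType R) (cp : crossed_product B).

Definition delta (v : vertex E) (g : G) : B := iAG cp (c0_delta R v) g.

Definition integrated_form (X : hilbertModType B) (pi : A -> X -> X)
    (U : G -> X -> X) (L : B -> X -> X) : Prop :=
  star_rep L /\ forall a g x, L (iAG cp a g) x = pi a (U g x).

Variable phi : G -> edge E -> G.

(* chi e g is the image in the completion Y of the characteristic function of
   {(e, g)}; as these functions form a basis of C_c(E^1 x G), the density of
   their span says that Y is the completion of C_c(E^1 x G). *)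
Record is_Yphi (Y : corrType B) (chi : edge E -> G -> Y) : Prop := IsYphi {
  chi_dense : dense (lspan (fun p : edge E * G => chi p.1 p.2));
  chi_inner : forall e g e' h, inner (chi e g) (chi e' h) =
    (if e == e' then delta (vact act g^-1%g (src e)) (g^-1 * h)%g else 0) :> B;
  chi_ract : forall e h v g, ract (chi e h) (delta v g) =
    (if src e == vact act h v then chi e (h * g)%g else 0);
  chi_lact : forall v g e h, lact (delta v g) (chi e h) =
    (if v == rng (eact act g e) then chi (eact act g e) (phi g e * h)%g
     else 0) }.

Definition Be (e : edge E) : set B := range (iA cp (c0_delta R (src e))).

(* coord identifies M with the families (m_e) such that m_e \in Be e and the
   sum of the m_e^* m_e converges (unconditionally, in norm). *)
Record is_ExelPardo (M : corrType B) (coord : M -> edge E -> B) : Prop :=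
  IsExelPardo {
  coord_linear : forall e, linear (coord^~ e);
  coord_inj : injective coord;
  coord_mem : forall m e, Be e (coord m e);
  coord_onto : forall f : edge E -> B, (forall e, Be e (f e)) ->
    cvg ((fun F : {fset edge E} => \sum_(e <- F) star (f e) ** f e) @ totally) ->
    exists m, coord m = f;
  coord_ract : forall m b e, coord (ract m b) e = coord m e ** b;
  coord_inner : forall m n,
    (fun F : {fset edge E} => \sum_(e <- F) star (coord m e) ** coord n e)
      @ totally --> (inner m n : B);
  coord_lact : exists (pi : A -> M -> M) (U : G -> M -> M),
    [/\ covariant pi U,
        integrated_form pi U lact,
        forall v m e, coord (pi (c0_delta R v) m) e =
          (if v == rng e then coord m e else 0) &
        forall g m e, coord (U g m) e =
          iA cp (c0_delta R (src e))
            (iG cp (phi g (eact act g^-1%g e))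
              (coord m (eact act g^-1%g e)))] }.

End CrossedProduct.

(* Main.v *)
From HB Require Import structures.
Require Import Defs.
From mathcomp Require Import all_boot all_order all_algebra finmap complex.
From mathcomp Require Import all_classical all_reals all_analysis.
From mathcomp Require Import showcase.summability.

(** The isomorphism sends [y] in [Y] to the family of its coefficients
    [<chi_{e,1}, y>], indexed by the edges [e].

    The reason is that the vectors [chi_{e,1}] behave like an orthogonal basis
    of [Y]: they are pairwise orthogonal, [<chi_{e,1}, chi_{e,1}>] is the
    projection [delta_{s(e),1}], and [chi_{e,h} = chi_{e,1} . delta_{s(e),h}],
    so that they generate [Y] as a Hilbert module. Hence the partial sums
    [P_F y], the sum over [e] in [F] of [chi_{e,1} . <chi_{e,1}, y>], converge
    to [y] along the finite sets [F] of edges ([cvg_chi_sum_coef]), because they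
    do so on each [chi_{e,h}] and the [P_F] are uniformly bounded. Pairing with
    [x] gives the Parseval formula ([cvg_inner_coef]), which says at once that
    the coefficients of [y] form an element of [M] and that the map preserves
    inner products. Conversely, for [m] in [M] the partial sums of the series
    of the [chi_{e,1} . m_e] are Cauchy, and their limit has coefficients [m_e];
    so the map is onto. Commutation with the right action is immediate.

    For the left action, both sides are first computed on the elements
    [i_A(a) i_G(g)] of [B]. Multiplying by one point mass reduces [a] to a
    scalar, and then the two cocycle identities make the formulas agree
    ([chi_coef_lact_iAG], [coord_lact_iAG]). These elements span a dense
    subspace of [B], so it remains to know that [b |-> b . x] is continuous,
    that is, that representations of a C*-algebra by adjointable operators are
    bounded ([norm_rep_le]).

    Two general facts are obtained without spectral theory. First, a
    Cauchy-Schwarz inequality [|<x, y>| <= 4 |x| |y|], whose constant is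
    harmless, follows from polarization and the triangle inequality
    ([norm_inner_le]). Second, if [h] is selfadjoint with [|h| <= 1/2], the
    equation [(1 - s)^2 = 1 - h^2] has a selfadjoint solution [s] that commutes
    with [h], obtained as the fixed point of a contraction
    ([exists_selfadjoint_root]). Then [h + i (1 - s)] and [h - i (1 - s)] are
    formally unitary, so they act isometrically in every representation, and
    [h], being half of their sum, acts as a contraction. *)

Set Implicit Arguments.
Unset Strict Implicit.
Unset Printing Implicit Defensive.

Import Order.TTheory GRing.Theory Num.Theory.
Import numFieldNormedType.Exports.

Local Open Scope classical_set_scope.
Local Open Scope ring_scope.

#[local] Existing Instance totally_filter.

(** * Finite sums, linear maps and Lipschitz maps *)

Lemma sum_fsetD (I : choiceType) (V : nmodType) (u : I -> V)
    (F F0 : {fset I}) :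
  (F0 `<=` F)%fset ->
  \sum_(i <- F0) u i + \sum_(i <- (F `\` F0)%fset) u i = \sum_(i <- F) u i.
Proof.
move=> sF; rewrite -big_cat /=; apply: perm_big; apply: uniq_perm.
- rewrite cat_uniq !fset_uniq andbT /=; apply/hasPn => i /=.
  by rewrite inE => /andP[].
- exact: fset_uniq.
move=> i; rewrite mem_cat inE; case: (boolP (i \in F0)) => //= iF0.
by rewrite (fsubsetP sF).
Qed.

Section LinearRules.
Variables (K : pzRingType) (V W : lmodType K) (f : V -> W) (lf : linear f).
Let pf : {linear V -> W} := HB.pack f (GRing.isLinear.Build K V W *:%R f lf).

Lemma linear_0 : f 0 = 0. Proof. exact: (raddf0 pf). Qed.
Lemma linear_D x y : f (x + y) = f x + f y. Proof. exact: (raddfD pf). Qed.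
Lemma linear_B x y : f (x - y) = f x - f y. Proof. exact: (raddfB pf). Qed.
Lemma linear_Z k x : f (k *: x) = k *: f x. Proof. exact: (linearZ_LR pf). Qed.
Lemma linear_sumE (I : Type) (r : seq I) (u : I -> V) :
  f (\sum_(i <- r) u i) = \sum_(i <- r) f (u i).
Proof. exact: (raddf_sum pf). Qed.

End LinearRules.

Section LipschitzMaps.
Variables (K : numFieldType) (V W : normedModType K).

Lemma cvg_dist_le (C : K) (T : Type) (F : set_system T) {FF : Filter F}
    (u : T -> V) (v : T -> W) l m :
  (forall t, `|m - v t| <= C * `|l - u t|) -> u @ F --> l -> v @ F --> m.
Proof.
move=> vu /cvgrPdist_lt ul; apply/cvgrPdist_lt => e e0.
have C0 : 0 < `|C| + 1 by rewrite ltr_wpDl.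
near=> t; apply: (@le_lt_trans _ _ ((`|C| + 1) * `|l - u t|)).
  have h := le_trans (normr_ge0 _) (vu t).
  rewrite (le_trans (vu t)) // -[X in X <= _]ger0_norm // normrM normr_id.
  by rewrite ler_wpM2r // lerDl.
rewrite mulrC -ltr_pdivlMr //; near: t; apply: ul.
by rewrite divr_gt0.
Unshelve. all: by end_near.
Qed.

Lemma lipschitz_cvg (f : V -> W) (C : K) (T : Type) (F : set_system T)
    {FF : Filter F} (u : T -> V) (l : V) :
  linear f -> (forall x, `|f x| <= C * `|x|) -> u @ F --> l ->
  (f \o u) @ F --> f l.
Proof.
by move=> lf fC; apply: (@cvg_dist_le C) => t; rewrite /= -(linear_B lf).
Qed.

Lemma cvg_to_unique (T : Type) (F : set_system T) {FF : ProperFilter F}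
    (u : T -> V) (l m : V) : u @ F --> l -> u @ F --> m -> l = m.
Proof. exact: (@norm_cvg_unique _ V (u @ F) _ l m). Qed.

End LipschitzMaps.

(** The set where the two continuous maps differ is open, so if it were not
    empty it would contain a linear combination of the [t i]. *)
Lemma eq_lipschitz_dense (R : realType) (V W : normedModType R[i])
    (f g : V -> W) (C D : R[i]) (T : Type) (t : T -> V) :
  linear f -> linear g -> (forall x, `|f x| <= C * `|x|) ->
  (forall x, `|g x| <= D * `|x|) -> dense (lspan t) ->
  (forall i, f (t i) = g (t i)) -> f =1 g.
Proof.
move=> lf lg fC gD dS fg x.
pose d x := f x - g x.
have ld : linear d.
  by move=> k a b; rewrite /d lf lg scalerBr opprD addrACA.
have dC y : `|d y| <= (C + D) * `|y|.
  by rewrite (le_trans (ler_normB _ _)) // mulrDl lerD.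
have cd : continuous d.
  by move=> y; exact: (@lipschitz_cvg _ _ _ _ _ _ _ _ id y ld dC cvg_id).
have od : open (d @^-1` (~` [set 0])).
  apply: open_comp => [y _|]; first exact: cd.
  rewrite openC; apply: accessible_closed_set1.
  by apply: hausdorff_accessible; exact: norm_hausdorff.
apply/eqP/negP => fgx.
have [|z [/= dz [s zE]]] := dS (d @^-1` (~` [set 0])) _ od.
  by exists x => /eqP; rewrite subr_eq0.
apply: dz; rewrite zE (linear_sumE ld) big1 // => p _.
by rewrite (linear_Z ld) /d fg subrr scaler0.
Qed.

(** * Inner products in Hilbert modules *)
Section HilbertModules.
Variables (R : realType) (B : cstarType R).

Section InnerProduct.
Variable X : hilbertModType B.
Implicit Types x y z : X.
Local Notation "'<< x , y >>" := (@inner R B X x y).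

Lemma inner_Dl x y z : '<< x + y, z >> = '<< x, z >> + '<< y, z >>.
Proof.
by rewrite -!(inner_star z) -starD (linear_D (@inner_linear _ _ X z)).
Qed.

Lemma inner_Zl (k : R[i]) x z : '<< k *: x, z >> = k^* *: '<< x, z >>.
Proof.
by rewrite -!(inner_star z) -starZ (linear_Z (@inner_linear _ _ X z)).
Qed.

Lemma inner_Nl x z : '<< - x, z >> = - '<< x, z >>.
Proof. by rewrite -scaleN1r inner_Zl rmorphN1 scaleN1r. Qed.

Lemma inner_Bl x y z : '<< x - y, z >> = '<< x, z >> - '<< y, z >>.
Proof. by rewrite inner_Dl inner_Nl. Qed.

Lemma inner_Dr x y z : '<< x, y + z >> = '<< x, y >> + '<< x, z >>.
Proof. exact: (linear_D (@inner_linear _ _ X x)). Qed.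

Lemma inner_Zr (k : R[i]) x y : '<< x, k *: y >> = k *: '<< x, y >>.
Proof. exact: (linear_Z (@inner_linear _ _ X x)). Qed.

Lemma inner_Br x y z : '<< x, y - z >> = '<< x, y >> - '<< x, z >>.
Proof. exact: (linear_B (@inner_linear _ _ X x)). Qed.

Lemma inner_sumr (I : Type) (r : seq I) (u : I -> X) z :
  '<< z, \sum_(i <- r) u i >> = \sum_(i <- r) '<< z, u i >>.
Proof. exact: (linear_sumE (@inner_linear _ _ X z)). Qed.

Lemma inner_ractl x y (b : B) : '<< ract x b, y >> = star b ** '<< x, y >>.
Proof. by rewrite -(inner_star y) inner_ract starM inner_star. Qed.

Lemma inner_injr x y : (forall z, '<< z, x >> = '<< z, y >>) -> x = y.
Proof.
move=> xy; apply/eqP; rewrite -subr_eq0; apply/eqP.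
by apply: (@inner_eq0 _ _ X); rewrite inner_Br xy subrr.
Qed.

(** Polarization, together with [|z|^2 = |<z, z>|] and the triangle inequality.
    The sum of [<u, v>] and its adjoint is controlled by [|u + v|^2] and
    [|u - v|^2]; using this for [(x, y)] and for [(x, i y)] isolates [<x, y>]. *)
Lemma norm_inner_le_sum x y : `|'<< x, y >>| <= (`|x| + `|y|) ^+ 2.
Proof.
have half u v : `|'<< u, v >> + '<< v, u >>| <= (`|u| + `|v|) ^+ 2.
  have E : 2%:R *: ('<< u, v >> + '<< v, u >>) =
      '<< u + v, u + v >> - '<< u - v, u - v >>.
    rewrite !(inner_Br, inner_Bl) !(inner_Dr, inner_Dl) scaler_nat mulr2n.
    rewrite !opprB.
    set a := '<< u, u >>; set b := '<< u, v >>.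
    set c := '<< v, u >>; set d := '<< v, v >>.
    rewrite (addrC (b - d)) (addrACA (a + c)) (addrC a) (addrACA c).
    rewrite (addrACA b d).
    by rewrite !subrr !addr0 [LHS]addrACA addrC.
  have : `|2%:R *: ('<< u, v >> + '<< v, u >>)| <= 2%:R * (`|u| + `|v|) ^+ 2.
    rewrite E (le_trans (ler_normB _ _)) // -!normr_inner mulr_natl mulr2n.
    rewrite lerD //.
      by rewrite lerXn2r ?nnegrE ?addr_ge0 // ler_normD.
    by rewrite lerXn2r ?nnegrE ?addr_ge0 // ler_normB.
  by rewrite normrZ normr_nat ler_pM2l.
have -> : '<< x, y >> = 2%:R^-1 *: (2%:R *: '<< x, y >>).
  by rewrite scalerA mulVf ?scale1r // pnatr_eq0.
have -> : 2%:R *: '<< x, y >> = ('<< x, y >> + '<< y, x >>)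
     - 'i *: ('<< x, 'i *: y >> + '<< 'i *: y, x >>).
  rewrite inner_Zr inner_Zl conjCi scalerDr !scalerA mulrN -expr2 sqrCi opprK.
  rewrite scaleN1r scale1r opprD opprK addrACA subrr addr0.
  by rewrite scaler_nat mulr2n.
rewrite normrZ normfV normr_nat ler_pdivrMl ?ltr0n //.
rewrite (le_trans (ler_normB _ _)) // mulr_natl mulr2n lerD // normrZ.
have ni : `|'i : R[i]| = 1 by apply: normCi.
by rewrite ni mul1r; have := half x ('i *: y); rewrite normrZ ni mul1r.
Qed.

(** Apply the preceding bound to [x / |x|] and [y / |y|], which gives the
    constant [(1 + 1)^2]. *)
Lemma norm_inner_le x y : `|'<< x, y >>| <= 4%:R * `|x| * `|y|.
Proof.
have [->|x0] := eqVneq x 0.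
  by rewrite -(scale0r (0 : X)) inner_Zl rmorph0 !scale0r !normr0 mulr0 mul0r.
have [->|y0] := eqVneq y 0.
  by rewrite (linear_0 (@inner_linear _ _ X x)) !normr0 mulr0.
have unit_norm z : z != 0 -> `| `|z|^-1 *: z| = 1.
  by move=> z0; rewrite normrZ normfV normr_id mulVf ?normr_eq0.
have := norm_inner_le_sum (`|x|^-1 *: x) (`|y|^-1 *: y).
rewrite !unit_norm // inner_Zr inner_Zl !normrZ norm_conjC !normfV !normr_id.
rewrite mulrCA ler_pdivrMl ?normr_gt0 // ler_pdivrMl ?normr_gt0 //.
move/le_trans; apply; rewrite -[1 + 1]/2%:R -natrX.
by rewrite [leRHS]mulrC [4%:R * _]mulrC.
Qed.

End InnerProduct.
End HilbertModules.

(** * Boundedness of representations of a C*-algebra *)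
Section CStar.
Variables (R : realType) (B : cstarType R).
Implicit Types a b c : B.

Lemma smulDl a b c : (a + b) ** c = a ** c + b ** c.
Proof. exact: (linear_D (smul_linearl c)). Qed.
Lemma smulDr a b c : a ** (b + c) = a ** b + a ** c.
Proof. exact: (linear_D (smul_linearr a)). Qed.
Lemma smulBl a b c : (a - b) ** c = a ** c - b ** c.
Proof. exact: (linear_B (smul_linearl c)). Qed.
Lemma smulBr a b c : a ** (b - c) = a ** b - a ** c.
Proof. exact: (linear_B (smul_linearr a)). Qed.
Lemma smul0b b : 0 ** b = 0 :> B.
Proof. exact: (linear_0 (smul_linearl b)). Qed.
Lemma smulb0 b : b ** 0 = 0 :> B.
Proof. exact: (linear_0 (smul_linearr b)). Qed.
Lemma smulZl k a b : (k *: a) ** b = k *: (a ** b).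
Proof. exact: (linear_Z (smul_linearl b)). Qed.
Lemma smulZr k a b : a ** (k *: b) = k *: (a ** b).
Proof. exact: (linear_Z (smul_linearr a)). Qed.
Lemma starN a : star (- a) = - star a.
Proof. by rewrite -scaleN1r starZ rmorphN1 scaleN1r. Qed.
Lemma star0 : star 0 = 0 :> B.
Proof. by rewrite -(scale0r (0 : B)) starZ rmorph0 !scale0r. Qed.
Lemma starB a b : star (a - b) = star a - star b.
Proof. by rewrite starD starN. Qed.

(** Multipliers act on [B], so identities between elements of [B] that come
    from multipliers are tested by multiplication on the right. *)
Lemma smul_inj a b : (forall c, a ** c = b ** c) -> a = b.
Proof.
move=> ab; apply/(can_inj (@starK _ B)).
apply: (@inner_injr _ _ (selfmod B)) => z.
rewrite -[LHS]/(star (z : B) ** star a) -[RHS]/(star (z : B) ** star b).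
by rewrite -!starM ab.
Qed.

Lemma norm_star a : `|star a| = `|a|.
Proof.
have half b : `|b| <= `|star b|.
  have [->|b0] := eqVneq b 0; first by rewrite normr0.
  rewrite -(@ler_pM2r _ `|b|) ?normr_gt0 // -expr2 -normr_cstar.
  exact: normr_smul.
by apply/eqP; rewrite eq_le half andbT -{2}[a]starK half.
Qed.

(** A positive element of [R[i]] is a real number, so the archimedean property
    of [R] applies. *)
Lemma exists_pow_half_lt (e : R[i]) : 0 < e -> exists n, 2%:R ^- n < e.
Proof.
move=> e0; have er : e = (complex.Re e)%:C%C by rewrite RRe_real // gtr0_real.
have r0 : 0 < complex.Re e by rewrite -ltcR -er.
have := archi_boundP (ltW (divr_gt0 ltr01 r0)).
set n := Num.bound _ => rn; exists n.
rewrite er -(rmorph_nat (real_complex R)) -rmorphXn -fmorphV ltcR.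
rewrite -[ltRHS]invrK ltf_pV2 ?posrE ?invr_gt0 ?exprn_gt0 //.
rewrite div1r in rn; rewrite (lt_trans rn) // -natrX ltr_nat.
exact: ltn_expl.
Qed.

(** The equation says [(1 - s)^2 = 1 - h^2] without using a unit. The map
    [T s = (h^2 + s^2) / 2] sends the ball of radius [1/2] to itself and
    contracts distances by [1/2] there; the iterates of [T] from [0] are
    selfadjoint and commute with [h], hence so does their limit. *)
Lemma exists_selfadjoint_root (h : B) : star h = h -> `|h| <= 2%:R^-1 ->
  exists s : B, [/\ star s = s, h ** s = s ** h & h ** h + s ** s = s + s].
Proof.
move=> sh h2; pose T s := 2%:R^-1 *: (h ** h + s ** s).
pose good s := [/\ star s = s, h ** s = s ** h & `|s| <= 2%:R^-1].
pose s_ n := iter n T 0.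
have norm_sq a b : `|a| <= 2%:R^-1 -> `|b| <= 2%:R^-1 -> `|a ** b| <= 2%:R^-1.
  move=> a2 b2; rewrite (le_trans (normr_smul _ _)) //.
  rewrite -[leRHS]mulr1 ler_pM // (le_trans b2) // invf_le1 ?ler1n //.
have goodT s : good s -> good (T s).
  case=> ss hs ns; split; rewrite /T.
  - by rewrite starZ starD !starM ss sh conj_Creal // rpredV.
  - by rewrite smulZr smulZl smulDr smulDl !smulA hs -!smulA hs smulA.
  rewrite normrZ normfV normr_nat ler_pdivrMl ?ltr0n //.
  by rewrite mulr_natl mulr2n (le_trans (ler_normD _ _)) // lerD // norm_sq.
have good0 : good 0.
  by split; rewrite ?star0 ?smul0b ?smulb0 ?normr0 ?invr_ge0.
have good_ n : good (s_ n) by elim: n => //= n; exact: goodT.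
have dist_sq a b : `|a ** a - b ** b| <= (`|a| + `|b|) * `|a - b|.
  have -> : a ** a - b ** b = a ** (a - b) + (a - b) ** b.
    by rewrite smulBl smulBr addrA subrK.
  rewrite (le_trans (ler_normD _ _)) // mulrDl lerD ?normr_smul //.
  by rewrite mulrC normr_smul.
have distT s t : T s - T t = 2%:R^-1 *: (s ** s - t ** t).
  by rewrite -scalerBr opprD addrACA subrr add0r.
have contr n k : `|s_ n - s_ (n + k)%N| <= 2%:R ^- n.
  elim: n => [|n IH].
    rewrite expr0 invr1 /s_ /= sub0r normrN.
    have [_ _ /le_trans] := good_ k; apply; rewrite invf_le1 ?ler1n //.
  rewrite addSn /= distT normrZ normfV normr_nat exprSr invfM mulrC.
  rewrite ler_wpM2r ?invr_ge0 // (le_trans (dist_sq _ _)) //.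
  apply: le_trans IH; rewrite -[leRHS]mul1r ler_wpM2r //.
  have [_ _ ?] := good_ n; have [_ _ ?] := good_ (n + k)%N.
  by rewrite [leRHS]splitr div1r lerD.
have cs : cvg (s_ @ \oo).
  apply: cauchy_cvg; apply: cauchy_exP => e /exists_pow_half_lt[n ne].
  exists (s_ n); exists n => // m /= nm; rewrite -ball_normE /=.
  by rewrite -(subnKC nm) (le_lt_trans (contr _ _)).
have [s ls] : exists s : B, s_ @ \oo --> s.
  by exists (lim (s_ @ \oo) : B).
exists s; split.
- apply: (cvg_to_unique _ ls); apply: (cvg_dist_le (C := 1) _ ls) => n.
  by have [ss _ _] := good_ n; rewrite -{1}ss -starB norm_star mul1r.
- apply: (@cvg_to_unique _ _ _ \oo _ (fun n => h ** s_ n)).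
    by apply: (cvg_dist_le (C := `|h|) _ ls) => n; rewrite -smulBr normr_smul.
  apply: (cvg_dist_le (C := `|h|) _ ls) => n; have [_ -> _] := good_ n.
  by rewrite -smulBl mulrC normr_smul.
have fix_s : T s = s.
  apply: (@cvg_to_unique _ _ _ \oo _ (fun n => s_ n.+1)); last first.
    by have := ls; rewrite -(cvg_shiftS s_).
  apply: (cvg_dist_le (C := `|s| + 2%:R^-1) _ ls) => n.
  rewrite /= distT normrZ normfV normr_nat ler_pdivrMl ?ltr0n //.
  rewrite (le_trans (dist_sq _ _)) // mulrA ler_wpM2r //.
  have [_ _ nn] := good_ n.
  apply: (le_trans (lerD (lexx _) nn)).
  by rewrite ler_peMl ?ler1n // addr_ge0 // invr_ge0.
by rewrite -{3 4}fix_s -mulr2n -scaler_nat scalerA divff ?scale1r.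
Qed.

Section Representation.
Variables (X : hilbertModType B) (L : B -> X -> X) (rL : star_rep L).

Let LD b c x : L (b + c) x = L b x + L c x.
Proof. by have [lL _ _] := rL; exact: (linear_D (lL x)). Qed.

Let LZ k b x : L (k *: b) x = k *: L b x.
Proof. by have [lL _ _] := rL; exact: (linear_Z (lL x)). Qed.

(** With [s] as above, [u = h + e (1 - s)] satisfies [u^* u = 1] for [e = i] and
    for [e = - i], since [h^2 + (1 - s)^2 = 1] and [h] and [s] commute; and [2 h]
    is the sum of these two elements. *)
Lemma norm_rep_selfadjoint_le1 (h : B) x :
  star h = h -> `|h| <= 2%:R^-1 -> `|L h x| <= `|x|.
Proof.
move=> sh /(exists_selfadjoint_root sh)[s [ss hs sE]].
have [_ LM Ladj] := rL.
have iso (e : R[i]) : e^* = - e -> e * e = - 1 ->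
    `|L h x + e *: (x - L s x)| = `|x|.
  move=> ec ee; apply/eqP; rewrite -(@eqrXn2 _ 2) // !normr_inner; apply/eqP.
  congr (`| _ |).
  have ac : inner (L h x) (x - L s x) = inner (x - L s x) (L h x) :> B.
    by rewrite inner_Br inner_Bl !Ladj sh ss -!LM hs.
  rewrite inner_Dr !inner_Dl !inner_Zr !inner_Zl ec scalerA mulrN ee opprK.
  rewrite scale1r ac scaleNr addrA subrK.
  rewrite inner_Br !inner_Bl !Ladj sh ss -!LM.
  have /(congr1 (fun b => inner x (L b x) : B)) := sE.
  rewrite !LD !inner_Dr => /(canRL (addrK _)) ->.
  set p := inner x (L s x) : B; set q := inner x (L _ x) : B.
  rewrite opprB (addrC q) (addrA (_ - p)) addrC addrACA subrr addr0.
  by rewrite addrA !subrK.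
have Lh : 2%:R *: L h x =
    (L h x + 'i *: (x - L s x)) + (L h x + (- 'i) *: (x - L s x)).
  by rewrite addrACA scaleNr subrr addr0 scaler_nat mulr2n.
have : `|2%:R *: L h x| <= 2%:R * `|x|.
  rewrite Lh (le_trans (ler_normD _ _)) // iso ?conjCi -?expr2 ?sqrCi //.
  rewrite iso ?mulrNN -?expr2 ?sqrCi // ?rmorphN /= ?conjCi //.
  by rewrite mulr_natl mulr2n.
by rewrite normrZ normr_nat ler_pM2l.
Qed.

(** Scaling the preceding bound gives [|L h x| <= 2 |h| |x|] for selfadjoint
    [h]. For general [b] it is used for [star b ** b], as
    [|L b x|^2 = |<x, L (star b ** b) x>| <= 4 |x| (2 |b|^2 |x|)] and [8 <= 3^2]. *)
Lemma norm_rep_le b x : `|L b x| <= 3%:R * `|b| * `|x|.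
Proof.
have [_ LM Ladj] := rL.
have sa h : star h = h -> `|L h x| <= 2%:R * `|h| * `|x|.
  move=> sh; have [->|h0] := eqVneq h 0.
    by rewrite -(scale0r (0 : B)) LZ !scale0r !normr0 mulr0 mul0r.
  pose k : R[i] := (2%:R * `|h|)^-1.
  have k0 : 0 < k by rewrite invr_gt0 mulr_gt0 ?normr_gt0.
  have := @norm_rep_selfadjoint_le1 (k *: h) x.
  rewrite starZ sh conj_Creal ?gtr0_real // LZ !normrZ gtr0_norm //.
  have -> : k * `|h| = 2%:R^-1 by rewrite /k invfM divfK // normr_eq0.
  by move=> /(_ erefl (lexx _)); rewrite ler_pdivrMl // mulr_gt0 ?normr_gt0.
rewrite -(@ler_pXn2r _ 2) ?nnegrE ?mulr_ge0 // normr_inner Ladj -LM.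
rewrite (le_trans (norm_inner_le _ _)) //.
have := sa (star b ** b); rewrite starM starK normr_cstar => /(_ erefl) sab.
rewrite (le_trans (ler_wpM2l _ sab)) ?mulr_ge0 // !exprMn.
rewrite mulrACA -expr2 [4%:R * _]mulrA -natrM -natrX.
by rewrite !ler_wpM2r ?exprn_ge0 // ler_nat.
Qed.

End Representation.
End CStar.

(** * Calculus in the crossed product *)
Section PointMasses.
Variables (R : realType) (V : choiceType).
Local Notation dl := (c0_delta R).
Implicit Types (a : c0 R V) (v : V).

(** Multiplication by a point mass turns [a] into a scalar, so that the
    elements [iAG a g] can be treated for every [a] at once. *)
Lemma delta_mul v a : dl v ** a = a v *: dl v.
Proof.
apply: c0P => w; rewrite -[LHS]/((w == v)%:R * a w) -[RHS]/(a v * (w == v)%:R).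
by have [->|_] := eqVneq w v; rewrite ?mul1r ?mulr1 ?mul0r ?mulr0.
Qed.

Lemma mul_delta v a : a ** dl v = a v *: dl v.
Proof. by rewrite -delta_mul; apply: c0P => w /=; rewrite mulrC. Qed.

Lemma star_delta v : star (dl v) = dl v.
Proof. by apply: c0P => w /=; rewrite conjC_nat. Qed.

Lemma delta_diag v : dl v v = 1. Proof. by rewrite /= eqxx. Qed.

End PointMasses.

Section CrossedProductCalculus.
Variables (R : realType) (G : groupType) (E : digraph).
Variables (act : graph_action G E) (B : cstarType R).
Variable cp : crossed_product act B.
Local Notation A := (c0 R (vertex E)).
Local Notation dl := (c0_delta R).
Local Notation AG := (iAG cp).
Implicit Types (a : A) (g h : G) (b x y : B).

(** An adjointable operator is automatically a module map. Taken for the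
    operators [iA a] and [iG g], this makes them left multipliers of [B]. *)
Lemma adjoint_smulr (S T : selfmod B -> selfmod B) x b :
  (forall y z : selfmod B, inner (S y) z = inner y (T z) :> B) ->
  (S (x ** b) : B) = S x ** b.
Proof.
move=> ST; have TS (y z : selfmod B) : inner (T y) z = inner y (S z) :> B.
  rewrite -[LHS](@inner_star _ _ (selfmod B)) -ST.
  exact: (@inner_star _ _ (selfmod B)).
apply: (@inner_injr _ _ (selfmod B)) => z; rewrite -TS.
rewrite -[x ** b]/(@ract _ _ (selfmod B) x b).
by rewrite -[RHS]/(@inner _ _ (selfmod B) z (ract (S x) b)) !inner_ract TS.
Qed.

Lemma iA_smulr a x b : iA cp a (x ** b) = iA cp a x ** b :> B.
Proof.
have [[_ _ adjA] _ _] := cp_covariant cp.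
exact: (adjoint_smulr _ _ (adjA a)).
Qed.

Lemma iG_smulr g x b : iG cp g (x ** b) = iG cp g x ** b :> B.
Proof.
have [_ [_ _ adjG] _] := cp_covariant cp.
exact: (adjoint_smulr _ _ (adjG g)).
Qed.

Lemma iA_M a c x : iA cp (a ** c) x = iA cp a (iA cp c x).
Proof. by have [[_ iAM _] _ _] := cp_covariant cp; exact: iAM. Qed.

Lemma iG_M g h x : iG cp (g * h)%g x = iG cp g (iG cp h x).
Proof. by have [_ [_ iGM _] _] := cp_covariant cp; exact: iGM. Qed.

Lemma iG_1 x : iG cp 1%g x = x.
Proof. by have [_ [iG1 _ _] _] := cp_covariant cp; exact: iG1. Qed.

Lemma iG_iA g a x : iG cp g (iA cp a x) = iA cp (alpha act g a) (iG cp g x).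
Proof.
have [_ _ cov] := cp_covariant cp.
by rewrite cov -iG_M mulVg iG_1.
Qed.

Lemma iA_iAG a c g : iA cp a (AG c g) = AG (a ** c) g :> B.
Proof. by apply: smul_inj => x; rewrite -iA_smulr !iAGE iA_M. Qed.

Lemma iG_iAG h a g : iG cp h (AG a g) = AG (alpha act h a) (h * g)%g :> B.
Proof. by apply: smul_inj => x; rewrite -iG_smulr !iAGE iG_iA iG_M. Qed.

Lemma iAGM a c g h : AG a g ** AG c h = AG (a ** alpha act g c) (g * h)%g.
Proof. by rewrite iAGE iG_iAG iA_iAG. Qed.

Lemma iAGZ (k : R[i]) a g : AG (k *: a) g = k *: AG a g.
Proof.
apply: smul_inj => x; rewrite smulZl !iAGE.
have [[linA _ _] _ _] := cp_covariant cp.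
exact: (linear_Z (linA _)).
Qed.

Lemma star_iAG a g :
  star (AG a g) = AG (alpha act g^-1%g (star a)) g^-1%g.
Proof.
have [[_ _ adjA] [_ _ adjG] _] := cp_covariant cp.
apply: smul_inj => x; rewrite iAGE -iG_iA.
apply: (@inner_injr _ _ (selfmod B)) => z.
rewrite -adjG -adjA; rewrite -[RHS]/(star (iA cp a (iG cp g z) : B) ** x).
rewrite -[LHS]/(star (z : B) ** (star (AG a g) ** x)).
by rewrite smulA -starM iAGE.
Qed.

Lemma alpha_delta g v : alpha act g (dl v) = dl (vact act g v).
Proof.
apply: c0P => w /=; congr (nat_of_bool _)%:R.
apply/eqP/eqP => [<-|->].
  by rewrite -vactM mulgV vact1.
by rewrite -vactM mulVg vact1.
Qed.

Lemma iA_delta_smul v x : iA cp (dl v) x = delta cp v 1%g ** x :> B.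
Proof. by rewrite iAGE iG_1. Qed.

Lemma star_delta1 v : star (delta cp v 1%g) = delta cp v 1%g.
Proof. by rewrite star_iAG star_delta alpha_delta invg1 vact1. Qed.

End CrossedProductCalculus.

(** * Cocycles *)
Section Cocycle.
Variables (G : groupType) (E : digraph) (act : graph_action G E).
Variables (phi : G -> edge E -> G) (hphi : is_cocycle act phi).

Lemma cocycle1 e : phi 1%g e = 1%g.
Proof.
have [phiM _] := hphi; have := phiM 1%g 1%g e.
by rewrite mulg1 eact1 -[LHS]mulg1 => /mulgI.
Qed.

Lemma cocycleV g e : (phi g^-1%g e)^-1%g = phi g (eact act g^-1%g e).
Proof.
have [phiM _] := hphi.
apply/eqP; rewrite eq_sym -(inj_eq (mulIg (phi g^-1%g e))).
by rewrite mulVg -phiM mulgV cocycle1.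
Qed.

End Cocycle.

(** * Coefficients of an element of Y *)
Section Coefficients.
Variables (R : realType) (G : groupType) (E : digraph).
Variables (act : graph_action G E) (phi : G -> edge E -> G).
Variable hphi : is_cocycle act phi.
Variables (B : cstarType R) (cp : crossed_product act B).
Variables (Y : corrType B) (chi : edge E -> G -> Y).
Variable hY : is_Yphi cp phi chi.
Local Notation dl := (c0_delta R).
Local Notation AG := (iAG cp).
Implicit Types (e : edge E) (g h : G) (x y : Y) (F : {fset edge E}).

Definition chi_coef y e : B := inner (chi e 1%g) y.

(** For [f = chi_coef y] this is the partial sum [P_F y] of the expansion of
    [y]. *)
Definition chi_sum (f : edge E -> B) F : Y :=
  \sum_(e <- F) ract (chi e 1%g) (f e).

Lemma chi_sumB f F F0 : (F0 `<=` F)%fset ->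
  chi_sum f F - chi_sum f F0 = chi_sum f (F `\` F0)%fset.
Proof. by move=> sF; rewrite /chi_sum -(sum_fsetD _ sF) addrC addKr. Qed.

Lemma chi_ract1 e h : ract (chi e 1%g) (delta cp (src e) h) = chi e h.
Proof. by rewrite (chi_ract hY) vact1 eqxx mul1g. Qed.

Lemma inner_chi1 e e' : inner (chi e 1%g) (chi e' 1%g) =
  (if e == e' then delta cp (src e) 1%g else 0) :> B.
Proof. by rewrite (chi_inner hY) invg1 vact1 mulg1. Qed.

(** The coefficient at [e] lies in [Be e], because [chi_{e,1}] is fixed by the
    projection [delta_{s(e),1}]. *)
Lemma iA_chi_coef y e : iA cp (dl (src e)) (chi_coef y e) = chi_coef y e.
Proof.
rewrite [RHS]/chi_coef -(chi_ract1 e 1%g) inner_ractl star_delta1.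
by rewrite -iA_delta_smul.
Qed.

Lemma chi_coef_linear e : linear (chi_coef^~ e).
Proof. exact: (@inner_linear _ _ Y). Qed.

Lemma inner_chi_sumr y f F :
  inner y (chi_sum f F) = \sum_(e <- F) star (chi_coef y e) ** f e.
Proof.
rewrite inner_sumr; apply: eq_bigr => e _.
by rewrite inner_ract inner_star.
Qed.

Lemma chi_coef_sum (f : edge E -> B) F e :
  (forall e, iA cp (dl (src e)) (f e) = f e) ->
  chi_coef (chi_sum f F) e = if e \in F then f e else 0.
Proof.
move=> fB; rewrite /chi_coef inner_sumr.
have E' e' : inner (chi e 1%g) (ract (chi e' 1%g) (f e')) =
    (if e == e' then f e else 0) :> B.
  rewrite inner_ract inner_chi1; case: eqP => [<-|_]; last by rewrite smul0b.
  by rewrite -iA_delta_smul fB.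
under eq_bigr do rewrite E'.
case: ifP => eF; last first.
  rewrite big1_seq // => e' /= e'F; case: eqP => // ee'.
  by rewrite ee' e'F in eF.
rewrite (bigD1_seq e) ?fset_uniq //= eqxx big1 ?addr0 // => e'.
by rewrite eq_sym => /negPf ->.
Qed.

Lemma inner_chi_sum (f k : edge E -> B) F :
  (forall e, iA cp (dl (src e)) (f e) = f e) ->
  inner (chi_sum f F) (chi_sum k F) = \sum_(e <- F) star (f e) ** k e.
Proof.
move=> fB; rewrite inner_chi_sumr; apply: eq_big_seq => e eF.
by rewrite chi_coef_sum // eF.
Qed.

Lemma chi_sum_coef_linear F : linear (fun y => chi_sum (chi_coef y) F).
Proof.
move=> k x y; rewrite /chi_sum scaler_sumr -big_split /=; apply: eq_bigr => e _.
rewrite -(@ract_linearr _ _ Y); congr (ract _ _).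
exact: chi_coef_linear.
Qed.

(** The partial sum [z = P_F y] is an orthogonal projection of [y], so
    [|z|^2 = |<y, z>|]. *)
Lemma norm_chi_sum_coef F y : `|chi_sum (chi_coef y) F| <= 4%:R * `|y|.
Proof.
set z := chi_sum _ _; have [->|z0] := eqVneq z 0.
  by rewrite normr0 mulr_ge0.
rewrite -(@ler_pM2r _ `|z|) ?normr_gt0 // -expr2 normr_inner.
have -> : inner z z = inner y z :> B.
  by rewrite inner_chi_sum ?inner_chi_sumr //; exact: iA_chi_coef.
exact: norm_inner_le.
Qed.

(** [P_F] fixes [chi_{e,h}] as soon as [e] is in [F]: its only nonzero
    coefficient is [delta_{s(e),h}]. *)
Lemma chi_sum_coef_chi F e h :
  e \in F -> chi_sum (chi_coef (chi e h)) F = chi e h.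
Proof.
move=> eF; rewrite /chi_sum (bigD1_seq e) ?fset_uniq //= big1 => [|e' ee'].
  rewrite addr0 /chi_coef (chi_inner hY) eqxx invg1 vact1 mul1g.
  exact: chi_ract1.
rewrite /chi_coef (chi_inner hY) (negPf ee').
exact: (linear_0 (@ract_linearr _ _ Y _)).
Qed.

(** Approximate [y] by a combination [x] of the [chi_{e,h}]. Once [F] contains
    the edges of [x], [y - P_F y = (y - x) - P_F (y - x)] has norm at most
    [5 |y - x|]. *)
Lemma cvg_chi_sum_coef y : chi_sum (chi_coef y) F @[F --> totally] --> y.
Proof.
apply/cvgrPdist_lt => e e0.
have d0 : 0 < e / 5%:R by rewrite divr_gt0 ?ltr0n.
have ne : ball y (e / 5%:R) !=set0 by exists y; exact: ballxx.
have [x [xy [s xE]]] := chi_dense hY ne (ball_open _ _).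
exists [fset p.2.1 | p in s]%fset => // F /= sF.
have Fx : chi_sum (chi_coef x) F = x.
  rewrite [in LHS]xE (linear_sumE (chi_sum_coef_linear F)) xE.
  apply: eq_big_seq => p ps; rewrite (linear_Z (chi_sum_coef_linear F)).
  by rewrite chi_sum_coef_chi // (fsubsetP sF) //; apply/imfsetP; exists p.
have -> : y - chi_sum (chi_coef y) F = (y - x) - chi_sum (chi_coef (y - x)) F.
  by rewrite (linear_B (chi_sum_coef_linear F)) Fx opprB addrA subrK.
rewrite (le_lt_trans (ler_normB _ _)) //.
rewrite (le_lt_trans (lerD (lexx _) (norm_chi_sum_coef _ _))) //.
rewrite -[X in X + _]mul1r -mulrDl [1 + _]addrC mulrC -ltr_pdivlMr //.
by rewrite natr1; move: xy; rewrite -ball_normE.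
Qed.

(** Parseval formula: apply [<x, .>] to the convergence of [P_F y] to [y]. *)
Lemma cvg_inner_coef x y :
  (fun F : {fset edge E} => \sum_(e <- F) star (chi_coef x e) ** chi_coef y e)
    @ totally --> (inner x y : B).
Proof.
have -> : (fun F => \sum_(e <- F) star (chi_coef x e) ** chi_coef y e) =
    inner x \o (fun F => chi_sum (chi_coef y) F).
  by apply/funext => F /=; rewrite inner_chi_sumr.
exact: (lipschitz_cvg (@inner_linear _ _ Y x) (fun z => norm_inner_le x z)
  (@cvg_chi_sum_coef y)).
Qed.

(** A finite block of the series has [<z, z>] equal to the corresponding block
    of the series of the [f_e^* f_e], hence a small norm. *)
Lemma is_cvg_chi_sum (f : edge E -> B) (l : B) :
  (forall e, iA cp (dl (src e)) (f e) = f e) ->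
  (fun F : {fset edge E} => \sum_(e <- F) star (f e) ** f e) @ totally --> l ->
  cvg (chi_sum f @ totally).
Proof.
move=> fB /cvgrPdist_lt fl; apply: cauchy_cvg; apply: cauchy_exP => r r0.
have [|F0 _ lF] := fl (r ^+ 2 / 2%:R); first by rewrite divr_gt0 ?exprn_gt0.
exists (chi_sum f F0); exists F0 => // F /= sF.
rewrite -ball_normE /= distrC (chi_sumB _ sF).
rewrite -(@ltr_pXn2r _ 2) ?nnegrE ?(ltW r0) // normr_inner.
have -> : inner (chi_sum f (F `\` F0)%fset) (chi_sum f (F `\` F0)%fset) =
    (l - \sum_(e <- F0) star (f e) ** f e) -
    (l - \sum_(e <- F) star (f e) ** f e) :> B.
  rewrite inner_chi_sum // [RHS]addrC opprB addrA subrK.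
  by rewrite -(sum_fsetD _ sF) addrC addKr.
rewrite (le_lt_trans (ler_normB _ _)) // [ltRHS]splitr ltrD //.
  by apply: lF => /=; exact: fsubset_refl.
exact: lF.
Qed.

(** As [chi_{e,1} = delta_{r(e),1} . chi_{e,1}], the element [iAG a g] may be
    replaced by [iAG a g ** delta_{r(e),1}], a multiple of [delta_{g r(e),g}]. *)
Lemma lact_iAG_chi1 a g e : lact (AG a g) (chi e 1%g) =
  a (vact act g (rng e)) *: chi (eact act g e) (phi g e).
Proof.
have [lin lM _] := @lact_star_rep _ _ Y.
have unit : lact (delta cp (rng e) 1%g) (chi e 1%g) = chi e 1%g.
  by rewrite (chi_lact hY) eact1 eqxx (cocycle1 hphi) mulg1.
rewrite -[in LHS]unit -lM iAGM alpha_delta mul_delta iAGZ mulg1.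
rewrite (linear_Z (lin _)) -/(delta _ _ _) (chi_lact hY) rng_act eqxx.
by rewrite mulg1.
Qed.

(** Move [iAG a g] to the other side of the inner product. Its adjoint maps
    [chi_{e,1}] to a multiple of [chi_{g^-1 e, phi(g^-1, e)}], which is
    [chi_{g^-1 e, 1}] times a [delta] whose adjoint is
    [delta_{s(e), phi(g, g^-1 e)}] by the two cocycle identities. *)
Lemma chi_coef_lact_iAG a g y e : chi_coef (lact (AG a g) y) e =
  a (rng e) *: iA cp (dl (src e)) (iG cp (phi g (eact act g^-1%g e))
    (chi_coef y (eact act g^-1%g e))).
Proof.
have [_ phis] := hphi; have [_ _ adj] := @lact_star_rep _ _ Y.
rewrite /chi_coef -{1}[AG a g]starK -adj star_iAG lact_iAG_chi1 inner_Zl.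
congr (_ *: _).
  by rewrite /= -vactM invgK mulgV vact1 conjCK.
rewrite -chi_ract1 inner_ractl star_iAG star_delta alpha_delta.
rewrite (cocycleV hphi) iAGE; congr (iA cp (dl _) _).
rewrite -(cocycleV hphi) src_act -phis -vactM mulVg.
exact: vact1.
Qed.

End Coefficients.

(** * Coordinates in the Exel-Pardo correspondence *)
Section ExelPardo.
Variables (R : realType) (G : groupType) (E : digraph).
Variables (act : graph_action G E) (phi : G -> edge E -> G).
Variables (B : cstarType R) (cp : crossed_product act B).
Variables (M : corrType B) (coord : M -> edge E -> B).
Variable hM : is_ExelPardo cp phi coord.
Local Notation dl := (c0_delta R).
Local Notation AG := (iAG cp).

Lemma BeP e (b : B) : Be cp e b <-> iA cp (dl (src e)) b = b.
Proof.
split=> [[c _ <-]|bE]; last by exists b.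
by rewrite -iA_M delta_mul delta_diag scale1r.
Qed.

Lemma iA_coord m e : iA cp (dl (src e)) (coord m e) = coord m e.
Proof. by apply/BeP; exact: (coord_mem hM). Qed.

(** The coordinate at [e] does not change under the point mass at [r(e)], and
    the product of this point mass with [a] is a scalar multiple of it. *)
Lemma coord_lact_iAG a g m e : coord (lact (AG a g) m) e =
  a (rng e) *: iA cp (dl (src e)) (iG cp (phi g (eact act g^-1%g e))
    (coord m (eact act g^-1%g e))).
Proof.
have [pi [U [[[pi_lin piM _] _ _] [_ intE] piE UE]]] := coord_lact hM.
rewrite intE -UE.
have -> n : coord (pi a n) e = coord (pi (dl (rng e)) (pi a n)) e.
  by rewrite piE eqxx.
rewrite -piM delta_mul (linear_Z (pi_lin _)) (linear_Z (coord_linear hM e)).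
by rewrite piE eqxx.
Qed.

(** The coordinate at [e] is the inner product with the element supported at
    [e]; in particular it is continuous. *)
Lemma inner_supp1 n m e :
  (forall e', coord n e' = if e' == e then delta cp (src e) 1%g else 0) ->
  inner n m = coord m e :> B.
Proof.
move=> nE; apply: (cvg_to_unique (coord_inner hM (m := n) (n := m))).
apply: cvg_near_cst; exists [fset e]%fset => // F /=; rewrite fsub1set => eF.
rewrite (bigD1_seq e) ?fset_uniq //= big1 => [|e' /negPf e'e].
  by rewrite addr0 nE eqxx star_delta1 -iA_delta_smul iA_coord.
by rewrite nE e'e star0 smul0b.
Qed.

End ExelPardo.

(** * The isomorphism *)
Theorem theorem6p1 (R : realType) (G : groupType) (E : digraph)
    (act : graph_action G E) (phi : G -> edge E -> G)
    (hphi : is_cocycle act phi)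
    (B : cstarType R) (cp : crossed_product act B)
    (Y : corrType B) (chi : edge E -> G -> Y) (hY : is_Yphi cp phi chi)
    (M : corrType B) (coord : M -> edge E -> B)
    (hM : is_ExelPardo cp phi coord) :
  exists Psi : Y -> M, corr_iso Psi.
Proof.
have PsiP y : exists m, coord m = chi_coef chi y.
  apply: (coord_onto hM) => [e|].
    by apply/BeP; exact: (iA_chi_coef hY).
  by apply/cvg_ex; exists (inner y y : B); exact: (cvg_inner_coef hY).
have [Psi PsiE] := choice PsiP.
have PsiL k x y : Psi (k *: x + y) = k *: Psi x + Psi y.
  apply: (coord_inj hM); apply/funext => e.
  rewrite PsiE (coord_linear hM) !PsiE; exact: (chi_coef_linear chi).
have iso x y : inner (Psi x) (Psi y) = inner x y :> B.
  apply: (cvg_to_unique (coord_inner hM (m := Psi x) (n := Psi y))).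
  by rewrite !PsiE; exact: (cvg_inner_coef hY).
exists Psi; split => //.
- move=> m _; pose f := coord m.
  have fB e : iA cp (c0_delta R (src e)) (f e) = f e by exact: (iA_coord hM).
  have cf : cvg (chi_sum chi f @ totally).
    exact: (is_cvg_chi_sum hY fB (coord_inner hM (m := m) (n := m))).
  have [y fy] : exists y : Y, chi_sum chi f @ totally --> y.
    by exists (lim (chi_sum chi f @ totally) : Y).
  exists y => //; apply: (coord_inj hM); rewrite PsiE; apply/funext => e.
  apply: (cvg_to_unique (lipschitz_cvg (chi_coef_linear chi e)
    (fun z => norm_inner_le (chi e 1%g) z) fy)).
  apply: cvg_near_cst; exists [fset e]%fset => // F /=; rewrite fsub1set => eF.
  by rewrite (chi_coef_sum hY) // eF.
- move=> b x; apply: (coord_inj hM); rewrite PsiE; apply/funext => e.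
  have [linY _ _] := @lact_star_rep _ _ Y.
  have [linM _ _] := @lact_star_rep _ _ M.
  have coordE m : coord m e = inner (Psi (chi e 1%g)) m.
    apply/esym; apply: (inner_supp1 hM) => e'.
    rewrite PsiE /chi_coef (inner_chi1 hY).
    by have [->|_] := eqVneq e' e.
  (* The constants are products of the Cauchy-Schwarz bound for the inner
     product with the vector that gives the coordinate at [e], and of the bound
     for the representation. *)
  move: b; apply: (@eq_lipschitz_dense _ B B
    (fun b => chi_coef chi (lact b x) e)
    (fun b => coord (lact b (Psi x)) e)
    (4%:R * `|chi e 1%g| * (3%:R * `|x|))
    (4%:R * `|Psi (chi e 1%g)| * (3%:R * `|Psi x|))
    _ _ _ _ _ _ (cp_dense cp) _).
  + by move=> k b c; rewrite linY; exact: (chi_coef_linear chi).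
  + by move=> k b c; rewrite linM; exact: (coord_linear hM).
  + move=> b; rewrite (le_trans (norm_inner_le _ _)) //.
    rewrite -[leRHS]mulrA ler_wpM2l ?mulr_ge0 //.
    by rewrite mulrAC; exact: (norm_rep_le (@lact_star_rep _ _ Y)).
  + move=> b; rewrite coordE (le_trans (norm_inner_le _ _)) //.
    rewrite -[leRHS]mulrA ler_wpM2l ?mulr_ge0 //.
    by rewrite mulrAC; exact: (norm_rep_le (@lact_star_rep _ _ M)).
  move=> [a g] /=; rewrite (chi_coef_lact_iAG hphi hY).
  by rewrite (coord_lact_iAG hM) PsiE.
- move=> b x; apply: (coord_inj hM); apply/funext => e.
  by rewrite (coord_ract hM) !PsiE /chi_coef inner_ract.
Qed.
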